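(* Let $d\ge2$, let $\mathcal{A}$ be a finite alphabet, and let $E=\mathcal{A}^{\mathbb{N}}$ be the full shift. For a shift $X\subseteq\mathcal{A}^{\mathbb{N}}$, let $E^{d-1}\times X\subseteq\mathcal{A}^{\mathcal{T}_d}$ denote the axial product on the $d$-tree of $E,\dots,E$ ($d-1$ times), $X$. 1. For every nonempty subshift $X\subseteq\mathcal{A}^{\mathbb{N}}$, \[ h\left(E^{d-1}\times X\right)=(d-1)^2\sum_{i=1}^\infty\frac{\log|\mathcal{P}(\mathbb{Z}_i,X)|}{d^{i+1}}. \] 2. For every nonempty subshift $\Omega\subseteq\mathcal{A}^{\mathbb{N}}$ and every sequence $\{a_n\}_{n=1}^\infty$ with $\lim_{n\to\infty}a_n=\infty$, as $n\to\infty$, \[ \log|\mathcal{P}(\Delta_n,E^{d-1}\times\Omega)|=|\Delta_n|\,h(E^{d-1}\times\Omega)+(d-1)^2\sum_{i=r_n+1}^\infty\frac{|\Delta_n|}{d^{i-1}}\log|\mathcal{P}(\mathbb{Z}_i,\Omega)|+o(a_n|\Delta_n|), \] where $r_n=\left\lfloor\frac{\log|\Delta_n|}{\log d}\right\rfloor$. In particular, when $d=2$, \[ \log|\mathcal{P}(\Delta_n,E\times\Omega)|=|\Delta_n|\,h(E\times\Omega)+O(n). \]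
   Context: $\mathbb{N}=\{1,2,\dots\}$ and $\mathbb{Z}_i=\{1,\dots,i\}$; for a subshift $X\subseteq\mathcal{A}^{\mathbb{N}}$, $\mathcal{P}(\mathbb{Z}_i,X)=\{(x_1,\dots,x_i):x\in X\}$. The $d$-tree $\mathcal{T}_d$ is the free monoid on generators $f_1,\dots,f_d$, with root $\epsilon$ and word length $|\cdot|$, and $\Delta_n=\{g\in\mathcal{T}_d:|g|\le n\}$. For $Y_1,\dots,Y_d\subseteq\mathcal{A}^{\mathbb{N}}$, the axial product $Y_1\times\cdots\times Y_d$ on $\mathcal{T}_d$ is the set of $x\in\mathcal{A}^{\mathcal{T}_d}$ such that for all $g\in\mathcal{T}_d$ and $1\le i\le d$ the sequence $(x_{gf_i^n})_{n\ge0}$ belongs to $Y_i$. For $Y\subseteq\mathcal{A}^{\mathcal{T}_d}$, $\mathcal{P}(\Delta_n,Y)=\{(x_g)_{g\in\Delta_n}:x\in Y\}$ and $h(Y)=\lim_{n\to\infty}\frac{\log|\mathcal{P}(\Delta_n,Y)|}{|\Delta_n|}$. *)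

(* Defs.v *)
From HB Require Import structures.
From mathcomp Require Import all_boot all_order all_algebra.
From mathcomp Require Import all_classical all_reals all_analysis.

Set Implicit Arguments.
Unset Strict Implicit.
Unset Printing Implicit Defensive.

Import Order.TTheory GRing.Theory Num.Theory.
Import numFieldNormedType.Exports.

Local Open Scope classical_set_scope.
Local Open Scope ring_scope.

(* A point of A^{1,2,...} is a function x : nat -> A, shifted by one: x j is
   the letter at position j + 1. *)
Definition shift_map (A : Type) (x : nat -> A) : nat -> A := fun n => x n.+1.

Definition subshift (A : finType) (X : set (nat -> A)) : Prop :=
  closed (X : set {ptws nat -> discrete_topology A}) /\
  @shift_map A @` X `<=` X.

(* P(Z_i, X): the words x_1 ... x_i, as functions of their 0-based index *)
Definition word_patterns (A : finType) (i : nat) (X : set (nat -> A)) :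
    set {ffun 'I_i -> A} :=
  [set [ffun j : 'I_i => x j] | x in X].
Arguments word_patterns {A} i X.

(* The d-tree is the free monoid seq 'I_d: the product is concatenation, the
   root is [::], the word length is size; f_1, ..., f_d are the letters
   0, ..., d - 1. *)
Definition tree (d : nat) : Type := seq 'I_d.

(* Delta_n: the library's type of sequences of size at most n *)
Definition Delta (d n : nat) : finType := n.-bseq 'I_d.

Definition axial_product (d : nat) (A : Type) (Y : 'I_d -> set (nat -> A)) :
    set (tree d -> A) :=
  [set x | forall (g : tree d) (i : 'I_d),
             Y i (fun n : nat => x (g ++ nseq n i))].

(* E^{d-1} x X: the factor of f_d is X, all the other factors are full shifts *)
Definition full_axial_product (d : nat) (A : Type) (X : set (nat -> A)) :
    set (tree d -> A) :=
  axial_product (fun i : 'I_d => if i.+1 == d then X else [set: nat -> A]).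
Arguments full_axial_product d {A} X.

Definition tree_patterns (d : nat) (A : finType) (n : nat)
    (Y : set (tree d -> A)) : set {ffun Delta d n -> A} :=
  [set [ffun g : Delta d n => x (bseqval g)] | x in Y].
Arguments tree_patterns {d A} n Y.

Definition entropy_seq (R : realType) (d : nat) (A : finType)
    (Y : set (tree d -> A)) : R^nat :=
  fun n => ln (#|tree_patterns n Y|%:R) / #|Delta d n|%:R.

Definition entropy (R : realType) (d : nat) (A : finType)
    (Y : set (tree d -> A)) : R :=
  limn (entropy_seq R Y).

(* r_n = floor (log |Delta_n| / log d); the quotient is nonnegative for
   d >= 2, where truncn is the floor function. *)
Definition rdepth (R : realType) (d n : nat) : nat :=
  Num.truncn (ln (#|Delta d n|%:R : R) / ln d%:R).

(* Main.v *)
(* Delta_n splits into the chains g, g f_d, g f_d^2, ... started at the words g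
   that do not end in f_d. The other factors being full shifts, a pattern on
   Delta_n is an independent choice of one word of X per chain, of length
   n + 1 - |g|. There are (d - 1) d^(k-1) starting words of length k >= 1, so
   with L_i = log |P(Z_i, X)|,
     log |P(Delta_n)| = L_(n+1) + (d - 1) sum_(1 <= i <= n) d^(n-i) L_i.
   Since 0 <= L_i <= i log |A| and (d - 1)|Delta_n| = d^(n+1) - 1, this differs
   from |Delta_n| (d - 1)^2 sum_(i >= 1) L_i / d^(i+1) by at most a constant times
   (n + 1) 2^-n |Delta_n|. That quantity is o(|Delta_n|), which gives the entropy;
   it is O(n) when d = 2; and, like the sum over i > r_n, it is O(|Delta_n|),
   hence o(a_n |Delta_n|). *)
Require Import Defs.
From HB Require Import structures.
From mathcomp Require Import all_boot all_order all_algebra.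
From mathcomp Require Import all_classical all_reals all_analysis.
From mathcomp Require Import zify ring lra.

Set Implicit Arguments.
Unset Strict Implicit.
Unset Printing Implicit Defensive.

Import Order.TTheory GRing.Theory Num.Theory.
Import numFieldNormedType.Exports.

Local Open Scope classical_set_scope.
Local Open Scope ring_scope.

(** * Splitting a word into a chain start and a trailing run of one letter *)

Section Chains.
Variables (T : eqType) (f : T).
Implicit Types s h : seq T.

(** The length of the longest suffix consisting of [f] only: the first other letter is searched for
    in the reversed word. *)
Definition run s : nat := find (predC1 f) (rev s).

Definition chain_base s : seq T := take (size s - run s) s.

Definition chain_start s : bool := run s == 0%N.

Lemma run_rcons s x : run (rcons s x) = if x == f then (run s).+1 else 0%N.
Proof. by rewrite /run rev_rcons /=; case: eqP. Qed.

Lemma chain_start_rcons s x : chain_start (rcons s x) = (x != f).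
Proof. by rewrite /chain_start run_rcons; case: (x == f). Qed.

Lemma run_size s : (run s <= size s)%N.
Proof. by rewrite /run -(size_rev s) find_size. Qed.

Lemma chain_base_rcons s x :
  chain_base (rcons s x) = if x == f then chain_base s else rcons s x.
Proof.
rewrite /chain_base run_rcons size_rcons; case: eqP => [_|_].
  by rewrite subSS -cats1 take_cat ltn_neqAle leq_subr andbT; case: eqP => // ->;
     rewrite subnn take0 cats0 take_size.
by rewrite subn0 -(size_rcons s x) take_size.
Qed.

Lemma chain_baseK s : chain_base s ++ nseq (run s) f = s.
Proof.
elim/last_ind: s => [//|s x IHs]; rewrite chain_base_rcons run_rcons.
case: eqP => [->|_]; last by rewrite cats0.
by rewrite -{3}IHs -addn1 nseqD catA cats1.
Qed.

Lemma size_chain_base s : (size (chain_base s) + run s)%N = size s.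
Proof. by rewrite -{3}(chain_baseK s) size_cat size_nseq. Qed.

Lemma chain_base_start s : chain_start (chain_base s).
Proof.
elim/last_ind: s => [//|s x IHs]; rewrite chain_base_rcons.
by case: eqP => // /eqP xf; rewrite chain_start_rcons.
Qed.

Lemma run_cat_nseq s j : run (s ++ nseq j f) = (run s + j)%N.
Proof.
elim: j => [|j IHj]; first by rewrite cats0 addn0.
by rewrite -addn1 nseqD catA cats1 run_rcons eqxx IHj addn1 addnS.
Qed.

Lemma chain_base_cat_nseq s j : chain_base (s ++ nseq j f) = chain_base s.
Proof.
elim: j => [|j IHj]; first by rewrite cats0.
by rewrite -addn1 nseqD catA cats1 chain_base_rcons eqxx.
Qed.

Lemma chain_base_id s : chain_start s -> chain_base s = s.
Proof. by move=> /eqP s0; rewrite /chain_base s0 subn0 take_size. Qed.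

End Chains.

(** * Counting and summing over chain starts, length by length *)

Lemma card_chain_starts (T : finType) (f : T) (k : nat) :
  #|[pred t : k.+1.-tuple T | chain_start f t]| = (#|T|.-1 * #|T| ^ k)%N.
Proof.
set P := [pred t : _ | _].
(* The complement is easier to count: the words ending in [f] are the injective image of the
   [k]-tuples under appending [f]. *)
have cardPC : #|predC P| = (#|T| ^ k)%N.
  rewrite -card_tuple -(@card_imset _ _ (fun t : k.-tuple T => [tuple of rcons t f])).
    apply: eq_card => t; rewrite !inE; apply/idP/imsetP => [|[u _ ->]].
      case: t => s sz; elim/last_ind: s sz => // s x _ sz /=.
      rewrite chain_start_rcons negbK => /eqP xf.
      have sz' : size s == k by rewrite size_rcons in sz.
      by exists (Tuple sz') => //; apply: val_inj; rewrite /= xf.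
    by rewrite /= chain_start_rcons eqxx.
  move=> t u /(congr1 val) /= /eqP; rewrite eqseq_rcons => /andP[/eqP tu _].
  exact: val_inj.
have := cardC P; rewrite cardPC card_tuple => /(congr1 (subn^~ (#|T| ^ k)%N)).
by rewrite addnK => ->; rewrite -subn1 mulnBl mul1n expnS.
Qed.

Lemma big_bseq (R : Type) (idx : R) (op : Monoid.com_law idx) (T : finType)
    (n : nat) (P : pred (seq T)) (F : seq T -> R) :
  \big[op/idx]_(g : n.-bseq T | P g) F g =
  \big[op/idx]_(k < n.+1) \big[op/idx]_(t : k.-tuple T | P t) F t.
Proof.
rewrite (@sig_big_dep _ _ _ _ (fun k : 'I_n.+1 => k.-tuple T : finType) xpredT
  (fun k t => P t) (fun k t => F t)) /=.
by rewrite (reindex (@tagged_tuple_bseq n T)) //=; apply: onW_bij.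
Qed.

Lemma sum_chain_starts (R : pzSemiRingType) (T : finType) (f : T) (n : nat)
    (F : nat -> R) :
  \sum_(g : n.-bseq T | chain_start f g) F (size g) =
  F 0%N + #|T|.-1%:R * \sum_(k < n) #|T|%:R ^+ k * F k.+1.
Proof.
rewrite (big_bseq _ n (chain_start f) (fun s => F (size s))) big_ord_recl /=.
congr (_ + _).
  rewrite (big_pred1 [tuple]) // => t.
  by rewrite (tuple0 t); apply/esym/eqP.
rewrite big_distrr /=; apply: eq_bigr => k _.
rewrite (eq_bigr (fun=> F k.+1)); last by move=> t _; rewrite size_tuple.
rewrite sumr_const card_chain_starts mulrA -natrX -natrM.
by rewrite mulr_natl.
Qed.

(** * Cardinalities of images and of sets of padded words *)

Lemma card_set_image (T U : finType) (S : set T) (phi : T -> U) :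
  {in S &, injective phi} -> #|phi @` S| = #|S|.
Proof.
move=> phi_inj; rewrite -(card_in_imset phi_inj); apply: eq_card => u.
apply/idP/imsetP => [|[x xS ->]].
  by rewrite inE => -[x xS <-]; exists x => //; rewrite inE.
by rewrite inE; exists x => //; move: xS; rewrite inE.
Qed.

(* Words of all lengths k <= n live in the single type {ffun 'I_n -> A}, filled
   up with a0 beyond k. *)
Section PaddedWords.
Variables (A : finType) (a0 : A) (n : nat).

Definition pad (k : nat) (x : nat -> A) : {ffun 'I_n -> A} :=
  [ffun j : 'I_n => if (j < k)%N then x j else a0].

Lemma card_padded (k : nat) (X : set (nat -> A)) :
  (k <= n)%N -> #|pad k @` X| = #|word_patterns k X|.
Proof.
move=> kn.
pose ext (w : {ffun 'I_k -> A}) : {ffun 'I_n -> A} :=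
  [ffun j : 'I_n => if insub (j : nat) is Some i then w i else a0].
have -> : pad k @` X = ext @` word_patterns k X.
  have extE (x : nat -> A) : ext [ffun j : 'I_k => x j] = pad k x.
    apply/ffunP => j; rewrite !ffunE; case: insubP => [i -> ij|/negPf -> //].
    by rewrite ffunE ij.
  apply/seteqP; split=> [_ [x Xx <-]|_ [_ [x Xx <-] <-]].
    by exists [ffun j : 'I_k => x j]; [exists x | rewrite extE].
  by exists x => //; rewrite extE.
(* Padding loses nothing because [k <= n]: each position of a word of length [k] is still a position
   in ['I_n]. *)
apply: card_set_image => v w _ _ /ffunP vw; apply/ffunP => i.
have := vw (widen_ord kn i); rewrite !ffunE.
by case: insubP => [j _ /= /val_inj ->|] //; rewrite /= ltn_ord.
Qed.

End PaddedWords.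

(** * Tree patterns as independent choices of one word per chain *)

Section TreePatterns.
Variables (d : nat) (A : finType) (X : set (nat -> A)) (f : 'I_d).
Hypotheses (f_last : f.+1 = d) (X0 : X !=set0).
Hypothesis X_shift : @shift_map A @` X `<=` X.

Lemma shift_iter (x : nat -> A) (m : nat) : X x -> X (fun n => x (m + n)%N).
Proof.
move=> Xx; elim: m => [//|m IHm].
have := X_shift (imageP (@shift_map A) IHm); rewrite /shift_map.
by under eq_fun do rewrite addnS -addSn.
Qed.

(* Shift invariance lets the condition be checked at chain starts only. *)
Lemma full_axial_productP (x : tree d -> A) :
  full_axial_product d X x <->
  forall g, chain_start f g -> X (fun n => x (g ++ nseq n f)).
Proof.
split=> [Yx g _|Xx g i]; first by have := Yx g f; rewrite f_last eqxx.
case: eqP => [id|//].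
have {id} -> : i = f by apply: val_inj; apply: succn_inj; rewrite id.
have := shift_iter (run f g) (Xx _ (chain_base_start f g)).
by under eq_fun do rewrite nseqD catA chain_baseK.
Qed.

(** The map [phi] records at each [g] the padded word read along [g], [g f], [g f^2], and so on. It
    is injective, and its image on tree patterns is the full family of independent choices [W],
    whose cardinality is a product. *)
Lemma card_tree_patterns (n : nat) :
  #|tree_patterns n (full_axial_product d X)| =
  (\prod_(g : n.-bseq 'I_d | chain_start f g)
      #|word_patterns (n.+1 - size g) X|)%N.
Proof.
have [x0 Xx0] := X0; pose a0 := x0 0%N.
(* Length 0 away from chain starts leaves a single padded word there, hence a factor 1, so the
   product may run over all of [Delta d n]. *)
pose len (g : seq 'I_d) := if chain_start f g then (n.+1 - size g)%N else 0%N.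
have len_le g : (len g <= n.+1)%N by rewrite /len; case: ifP => // _; apply: leq_subr.
pose phi (y : {ffun Delta d n -> A}) : {ffun Delta d n -> {ffun 'I_n.+1 -> A}} :=
  [ffun g : Delta d n => pad a0 n.+1 (len g) (fun j => y (insub_bseq n (g ++ nseq j f)))].
pose W (g : Delta d n) : pred {ffun 'I_n.+1 -> A} := mem (pad a0 n.+1 (len g) @` X).
have insubK (g : seq 'I_d) : (size g <= n)%N -> bseqval (insub_bseq n g) = g.
  by move=> gn; rewrite /insub_bseq /insubd insubT.
(* The letter at [g] is recovered from [phi] at index [run f g] of the word attached to
   [chain_base f g]. *)
have phi_inj : injective phi.
  move=> y z /ffunP yz; apply/ffunP => g.
  have bn : (size (chain_base f g) <= n)%N.
    by rewrite (leq_trans _ (size_bseq g)) // -(size_chain_base f g) leq_addr.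
  have rn : (run f g < n.+1)%N by rewrite ltnS (leq_trans (run_size _ _)) ?size_bseq.
  have := yz (insub_bseq n (chain_base f g)); rewrite !ffunE insubK //.
  move=> /ffunP /(_ (Ordinal rn)); rewrite !ffunE /len chain_base_start /=.
  rewrite ltn_subRL size_chain_base ltnS size_bseq chain_baseK.
  suff -> : insub_bseq n g = g by [].
  by apply: val_inj; rewrite /= insubK ?size_bseq.
have phi_tree : phi @` tree_patterns n (full_axial_product d X) = [set` family W].
  apply/seteqP; split => [_ [_ [x Yx <-] <-]|w /familyP wW].
    apply/familyP => g; rewrite ffunE /W inE; move/full_axial_productP: Yx => Xx.
    have [gs|gs] := boolP (chain_start f g).
      exists (fun j => x (g ++ nseq j f)); first exact: Xx.
      apply/ffunP => j; rewrite !ffunE; case: ifP => // jl; rewrite insubK //.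
      by move: jl; rewrite /len gs size_cat size_nseq ltn_subRL ltnS.
    by exists x0 => //; apply/ffunP => j; rewrite !ffunE /len (negPf gs) ltn0.
  (* A point of [X] is chosen at every word of the infinite tree, since the extension must be
     admissible everywhere; beyond depth [n] nothing is prescribed and [x0] serves. *)
  have /choice[c cP] (h : seq 'I_d) : exists z : nat -> A, X z /\
      ((size h <= n)%N -> w (insub_bseq n h) = pad a0 n.+1 (len h) z).
    have [hn|hn] := leqP (size h) n; last by exists x0; split.
    have := wW (insub_bseq n h); rewrite /W inE insubK // => -[x Xx xw].
    by exists x; split.
  (* Along the chain from a start [h], this reads off exactly the chosen point [c h]. *)
  pose x (g : tree d) := c (chain_base f g) (run f g).
  exists [ffun g : Delta d n => x (bseqval g)].
    exists x => //; apply/full_axial_productP => g gs; rewrite /x.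
    under eq_fun do rewrite chain_base_cat_nseq run_cat_nseq.
    by rewrite (eqP gs) chain_base_id //; have [] := cP g.
  apply/ffunP => g; rewrite ffunE.
  have := (cP g).2 (size_bseq g).
  have -> : insub_bseq n g = g by apply: val_inj; rewrite /= insubK ?size_bseq.
  move=> ->; apply/ffunP => j; rewrite !ffunE; case: ifP => // jl.
  have gs : chain_start f g by move: jl; rewrite /len; case: ifP.
  rewrite insubK; last by move: jl; rewrite /len gs size_cat size_nseq ltn_subRL ltnS.
  by rewrite /x chain_base_cat_nseq run_cat_nseq (eqP gs) chain_base_id.
have <- : #|phi @` tree_patterns n (full_axial_product d X)| =
          #|tree_patterns n (full_axial_product d X)|.
  by apply: card_set_image => y z _ _; apply: phi_inj.
rewrite phi_tree; have -> : #|[set` family W]| = #|family W|.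
  by apply: eq_card => w; apply/idP/idP; rewrite in_setE.
rewrite card_family foldrE big_map big_enum /= [RHS]big_mkcond /=.
apply: eq_bigr => g _.
have -> : #|W g| = #|pad a0 n.+1 (len g) @` X| by apply: eq_card => w; rewrite inE.
rewrite card_padded // /len; case: ifP => // _.
(* A word that is not a chain start contributes the empty word alone, which is a pattern because [X]
   is nonempty. *)
have w0 : {ffun 'I_0 -> A} := [ffun=> a0].
rewrite -(fintype.card1 w0); apply: eq_card => w; rewrite !inE.
apply/idP/eqP => [_|_]; first by apply/ffunP => -[].
by rewrite inE; exists x0 => //; apply/ffunP => -[].
Qed.

End TreePatterns.

(** * Bounds for the weighted series when [L] grows at most linearly *)

Section WeightedSeries.
Variables (R : realType) (d : nat) (L : R^nat) (C : R).
Hypotheses (d2 : (2 <= d)%N) (L_ge0 : forall i, 0 <= L i).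
Hypothesis L_le : forall i, L i <= C * i%:R.

Let u i := L i / d%:R ^+ i.+1.

Let dR2 : 2 <= d%:R :> R. Proof. by rewrite (ler_nat R 2 d). Qed.

Let expd_gt0 i : 0 < d%:R ^+ i :> R.
Proof. by rewrite exprn_gt0 // (lt_le_trans _ dR2). Qed.

Let exp2_le i : 2 ^+ i <= d%:R ^+ i :> R.
Proof. by rewrite lerXn2r // nnegrE ?ler0n. Qed.

Let C_ge0 : 0 <= C.
Proof. by have := le_trans (L_ge0 1) (L_le 1); rewrite mulr1. Qed.

Let u_ge0 i : 0 <= u i.
Proof. by rewrite divr_ge0 // ltW. Qed.

Lemma weighted_sum_ge0 m N : 0 <= \sum_(m <= i < N) u i.
Proof. by apply: sumr_ge0. Qed.

(* [i / 2^(i+1) = (i+1) / 2^i - (i+2) / 2^(i+1)] makes the bound telescope. *)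
Lemma weighted_sum_le m N : \sum_(m <= i < N) u i <= C * (m.+1%:R / 2 ^+ m).
Proof.
(* The sign makes the increments of [T] nonnegative; the telescoped sum [T N - T m] is then at most
   [- T m], the claimed bound. *)
pose T i : R := - (C * (i.+1%:R / 2 ^+ i)).
have T_le0 i : T i <= 0.
  by rewrite oppr_le0 mulr_ge0 // divr_ge0 // exprn_ge0.
have [Nm|mN] := leqP N m.
  by rewrite big_geq // -oppr_le0; apply: T_le0.
have /le_trans : \sum_(m <= i < N) u i <= \sum_(m <= i < N) (T i.+1 - T i).
  apply: ler_sum => i _.
  have -> : T i.+1 - T i = C * i%:R / 2 ^+ i.+1.
    rewrite /T -!natr1 exprS; field.
    by rewrite expf_neq0.
  apply: (@le_trans _ _ (C * i%:R / d%:R ^+ i.+1)).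
    by rewrite ler_pM2r ?invr_gt0.
  apply: ler_wpM2l; first by rewrite mulr_ge0.
  by rewrite lef_pV2 ?posrE ?expd_gt0 ?exprn_gt0 ?exp2_le.
apply; rewrite telescope_sumr 1?ltnW // -[leRHS]add0r -[X in _ <= _ + X]opprK.
by rewrite lerD2r T_le0.
Qed.

Lemma weighted_sum_cvg m : cvgn (fun N => \sum_(m <= i < N) u i).
Proof.
apply: nondecreasing_is_cvgn.
  apply/nondecreasing_seqP => N.
  have [mN|Nm] := leqP m N; first by rewrite big_nat_recr //= lerDl.
  by rewrite big_geq 1?ltnW // big_geq.
exists (C * (m.+1%:R / 2 ^+ m)) => _ [N _ <-]; exact: weighted_sum_le.
Qed.

Lemma weighted_tail_ge0 m : 0 <= \big[+%R/0]_(m <= i <oo) u i.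
Proof.
apply: limr_ge; first exact: weighted_sum_cvg.
by apply: nearW => N; apply: weighted_sum_ge0.
Qed.

Lemma weighted_tail_le m :
  \big[+%R/0]_(m <= i <oo) u i <= C * (m.+1%:R / 2 ^+ m).
Proof.
apply: limr_le; first exact: weighted_sum_cvg.
by apply: nearW => N; apply: weighted_sum_le.
Qed.

Lemma weighted_tail_split m n : (m <= n)%N ->
  \big[+%R/0]_(m <= i <oo) u i =
  \sum_(m <= i < n) u i + \big[+%R/0]_(n <= i <oo) u i.
Proof.
move=> mn; apply/cvg_lim => //.
have : (\sum_(m <= i < n) u i + \sum_(n <= i < N) u i) @[N --> \oo] -->
       \sum_(m <= i < n) u i + \big[+%R/0]_(n <= i <oo) u i.
  by apply: cvgD; [exact: cvg_cst | exact: weighted_sum_cvg].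
apply: cvg_trans; apply: near_eq_cvg; near=> N.
by rewrite -big_cat_nat //; near: N; exact: nbhs_infty_ge.
Unshelve. all: by end_near. Qed.

Lemma card_DeltaE n : (d%:R - 1) * #|Delta d n|%:R = d%:R ^+ n.+1 - 1 :> R.
Proof.
rewrite subrX1 card_bseq card_ord natr_sum; congr (_ * _).
by apply: eq_bigr => i _; rewrite natrX.
Qed.

Lemma exp2_le_card_Delta n : 2 ^+ n <= #|Delta d n|%:R :> R.
Proof.
apply: (le_trans (exp2_le n)).
rewrite -natrX ler_nat card_bseq card_ord big_ord_recr /=.
exact: leq_addl.
Qed.

(** Setting [i = n - k] turns the weight [d^k] into [d^(n+1) / d^(i+1)]. *)
Lemma chain_sumE n :
  L n.+1 + (d%:R - 1) * \sum_(k < n) d%:R ^+ k * L (n - k)%N =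
  L n.+1 + (d%:R - 1) * d%:R ^+ n.+1 * \sum_(1 <= i < n.+1) u i.
Proof.
congr (_ + _); rewrite -mulrA; congr (_ * _).
rewrite big_distrr big_add1 /= big_mkord (reindex_inj rev_ord_inj) /=.
apply: eq_bigr => k _; have kn := ltn_ord k; rewrite /u subKn //.
rewrite mulrCA mulrC; congr (_ * _); apply: (canRL (mulfK _)).
  exact: lt0r_neq0.
by rewrite -exprD; congr (_ ^+ _); lia.
Qed.

(** Splitting the series at [n + 1] into [s + t] and replacing [q^(n+1)] by [(q - 1) D + 1] cancels
    the terms in [D s]. What remains involves [L n.+1], [s] and [t D], each of which lies between 0
    and [C e D]. *)
Lemma chain_sum_error n :
  `|L n.+1 + (d%:R - 1) * \sum_(k < n) d%:R ^+ k * L (n - k)%N -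
    #|Delta d n|%:R * ((d%:R - 1) ^+ 2 * \big[+%R/0]_(1 <= i <oo) u i)| <=
  (1 + d%:R) ^+ 2 * C * (n.+1%:R / 2 ^+ n) * #|Delta d n|%:R.
Proof.
rewrite chain_sumE (weighted_tail_split (ltn0Sn n)).
set s := \sum_(1 <= i < n.+1) u i; set t := \big[+%R/0]_(n.+1 <= i <oo) u i.
set D := #|Delta d n|%:R; set e := n.+1%:R / 2 ^+ n; set q := d%:R.
have DE : (q - 1) * D = q ^+ n.+1 - 1 := card_DeltaE n.
have -> : L n.+1 + (q - 1) * q ^+ n.+1 * s - D * ((q - 1) ^+ 2 * (s + t)) =
  L n.+1 + (q - 1) * s - (q - 1) ^+ 2 * (t * D).
  have -> : q ^+ n.+1 = (q - 1) * D + 1 by rewrite DE subrK.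
  by ring.
have D2 : 2 ^+ n <= D := exp2_le_card_Delta n.
have p0 : 0 < 2 ^+ n :> R by rewrite exprn_gt0.
have D0 : 0 < D := lt_le_trans p0 D2.
have e0 : 0 <= e by rewrite divr_ge0 // ltW.
have neD : n.+1%:R <= e * D.
  by rewrite /e mulrAC ler_pdivlMr // ler_pM2l ?ltr0n.
have q2 : 2 <= q := dR2.
have L_bound : 0 <= L n.+1 <= C * (e * D).
  rewrite L_ge0 /=; apply: (le_trans (L_le _)).
  by rewrite ler_wpM2l.
(* From [m = 1] the partial sums are at most [C * (2 / 2) = C], and [1 <= n + 1 <= e D]. *)
have s_bound : 0 <= s <= C * (e * D).
  rewrite weighted_sum_ge0 /=; apply: (le_trans (weighted_sum_le _ _)).
  rewrite ler_wpM2l // expr1 divff ?pnatr_eq0 // (le_trans _ neD) //.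
  by rewrite ler1n.
(* The tail bound at [n + 1] reduces to [n + 2 <= 2 (n + 1)]. *)
have t_bound : 0 <= t * D <= C * (e * D).
  rewrite mulr_ge0 ?weighted_tail_ge0 ?(ltW D0) //= mulrA ler_pM2r //.
  apply: (le_trans (weighted_tail_le _)); rewrite ler_wpM2l // exprS /e.
  rewrite invfM mulrA ler_pM2r ?invr_gt0 // ler_pdivrMr // -natrM ler_nat.
  by lia.
have -> : (1 + q) ^+ 2 * C * e * D = (1 + q) ^+ 2 * (C * (e * D)) by ring.
set K := C * (e * D) in L_bound s_bound t_bound *.
move: (t * D) t_bound => tD /andP[t0 tK].
move/andP: L_bound => [l0 lK]; move/andP: s_bound => [s0 sK].
(* The three coefficients add up to [1 - q + q^2], which is at most [(1 + q)^2]. *)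
apply: (@le_trans _ _ (K + (q - 1) * K + (q - 1) ^+ 2 * K)).
  have q1 : 0 <= q - 1 by lra.
  apply: (le_trans (ler_normB _ _)); apply: lerD.
    rewrite ger0_norm ?addr_ge0 ?mulr_ge0 //; apply: lerD => //.
    exact: ler_wpM2l.
  rewrite ger0_norm ?mulr_ge0 // expr2 -!mulrA.
  by rewrite !ler_wpM2l.
have K0 : 0 <= K by apply: le_trans lK.
have -> : K + (q - 1) * K + (q - 1) ^+ 2 * K = (1 - q + q ^+ 2) * K by ring.
by rewrite ler_wpM2r //; nra.
Qed.

End WeightedSeries.

(** The terms of a convergent series tend to 0: with [d = 2] and [L i = i] they are [i / 2^(i+1)],
    and shifting the index by one and multiplying by 4 gives the sequence. *)
Lemma cvg_succ_div_exp2 (R : realType) :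
  (n.+1%:R / 2 ^+ n : R) @[n --> \oo] --> (0 : R).
Proof.
have := @weighted_sum_cvg R 2 (fun i => i%:R) 1 isT (ler0n R) _ 0%N.
have h i : i%:R <= 1 * i%:R :> R by rewrite mul1r.
move=> /(_ h) /cvg_series_cvg_0; rewrite -cvg_shiftS => /(@cvgMl_tmp _ _ _ _ _ 4).
rewrite mulr0; apply: cvg_trans; apply: near_eq_cvg; apply: nearW => n /=.
by rewrite !exprS; field; rewrite expf_neq0.
Qed.

Lemma ln_prod (R : realType) (I : finType) (P : pred I) (F : I -> R) :
  (forall i, 0 < F i) -> ln (\prod_(i | P i) F i) = \sum_(i | P i) ln (F i).
Proof.
(* Positivity is carried through the induction because [lnM] needs it for the partial products. *)
move=> F0; suff : 0 < \prod_(i | P i) F i /\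
    ln (\prod_(i | P i) F i) = \sum_(i | P i) ln (F i) by case.
elim/big_rec2: _ => [|i x y _ [y0 <-]]; first by rewrite ln1.
by rewrite mulr_gt0 // lnM ?posrE.
Qed.

(** * Entropy and remainder of the axial product *)

Section FullAxialProduct.
Variables (R : realType) (d : nat) (A : finType) (X : set (nat -> A)).
Hypotheses (d2 : (2 <= d)%N) (X0 : X !=set0) (X_shift : subshift X).

Local Notation L i := (ln (#|word_patterns i X|%:R : R)).

Lemma word_patterns_gt0 i : (0 < #|word_patterns i X|)%N.
Proof.
have [x Xx] := X0; apply/card_gt0P; exists [ffun j : 'I_i => x j].
by rewrite inE; exists x.
Qed.

Lemma ln_word_patterns_ge0 i : 0 <= L i.
Proof. by rewrite ln_ge0 // ler1n word_patterns_gt0. Qed.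

Lemma ln_word_patterns_le i : L i <= ln (#|A|%:R : R) * i%:R.
Proof.
have A0 : (0 < #|A|)%N by have [x _] := X0; apply/card_gt0P; exists (x 0%N).
rewrite mulr_natr -lnXn ?ltr0n // ler_ln ?posrE ?exprn_gt0 ?ltr0n //.
  by rewrite -natrX ler_nat -[X in (_ ^ X)%N]card_ord -card_ffun max_card.
exact: word_patterns_gt0.
Qed.

Lemma ln_tree_patterns n :
  ln (#|tree_patterns n (full_axial_product d X)|%:R : R) =
  L n.+1 + (d%:R - 1) * \sum_(k < n) d%:R ^+ k * L (n - k)%N.
Proof.
have [f f_last] : exists f : 'I_d, f.+1 = d.
  have dd : (d.-1 < d)%N by lia.
  by exists (Ordinal dd); rewrite /= prednK //; lia.
rewrite (card_tree_patterns f_last X0 X_shift.2) natr_prod ln_prod; last first.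
  by move=> g; rewrite ltr0n word_patterns_gt0.
have := sum_chain_starts f n (fun k => L (n.+1 - k)%N).
by rewrite card_ord subn0 -subn1 natrB //; lia.
Qed.

Let C : R := ln #|A|%:R.

Let h : R := (d%:R - 1) ^+ 2 * \big[+%R/0]_(1 <= i <oo) (L i / d%:R ^+ i.+1).

Lemma ln_tree_patterns_error n :
  `|ln (#|tree_patterns n (full_axial_product d X)|%:R : R) -
    #|Delta d n|%:R * h| <=
  (1 + d%:R) ^+ 2 * C * (n.+1%:R / 2 ^+ n) * #|Delta d n|%:R.
Proof.
rewrite ln_tree_patterns.
exact: (chain_sum_error d2 ln_word_patterns_ge0 ln_word_patterns_le).
Qed.

Lemma card_Delta_gt0 n : 0 < #|Delta d n|%:R :> R.
Proof. exact: lt_le_trans (exp2_le_card_Delta _ d2 n). Qed.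

(** Dividing the error estimate by the size of [Delta d n] leaves a constant times
    [(n + 1) / 2^n]. *)
Lemma entropy_seq_cvg :
  entropy_seq R (full_axial_product d X) n @[n --> \oo] --> h.
Proof.
apply/cvgrPdist_le => eps eps0.
set K := (1 + d%:R) ^+ 2 * C.
have : K * (n.+1%:R / 2 ^+ n) @[n --> \oo] --> 0.
  by rewrite -(mulr0 K); apply: cvgMl_tmp; exact: cvg_succ_div_exp2.
move=> /cvgr0Pnorm_le /(_ _ eps0); apply: filterS => n.
have D0 := card_Delta_gt0 n.
move=> /(le_trans (ler_norm _)); apply: le_trans.
have -> : h - entropy_seq R (full_axial_product d X) n =
    - ((ln (#|tree_patterns n (full_axial_product d X)|%:R : R) -
        #|Delta d n|%:R * h) / #|Delta d n|%:R).
  by rewrite /entropy_seq mulrBl [_ * h]mulrC mulfK ?lt0r_neq0 // opprB.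
rewrite normrN normrM normfV (gtr0_norm D0) ler_pdivrMr //.
exact: ln_tree_patterns_error.
Qed.

Lemma entropy_full_axial_product :
  entropy R (full_axial_product d X) = h.
Proof. by apply/cvg_lim => //; apply: entropy_seq_cvg. Qed.

(** The remainder is weighted by [d^(i-1)] and the entropy by [d^(i+1)], whence the factor [d^2]; it
    lets the bounds on the entropy series apply to the remainder. *)
Lemma remainder_termE n i : (0 < i)%N ->
  #|Delta d n|%:R / d%:R ^+ i.-1 * L i =
  d%:R ^+ 2 * #|Delta d n|%:R * (L i / d%:R ^+ i.+1).
Proof.
case: i => // i _; rewrite /= !exprS; field.
by rewrite expf_neq0 ?pnatr_eq0 //; lia.
Qed.

Lemma remainder_cvg n m : (0 < m)%N ->
  (fun N => \sum_(m <= i < N) #|Delta d n|%:R / d%:R ^+ i.-1 * L i) @ \oo -->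
  d%:R ^+ 2 * #|Delta d n|%:R * \big[+%R/0]_(m <= i <oo) (L i / d%:R ^+ i.+1).
Proof.
move=> m0.
have : d%:R ^+ 2 * #|Delta d n|%:R * (\sum_(m <= i < N) L i / d%:R ^+ i.+1)
    @[N --> \oo] --> d%:R ^+ 2 * #|Delta d n|%:R *
                     \big[+%R/0]_(m <= i <oo) (L i / d%:R ^+ i.+1).
  apply: cvgMl_tmp.
  by have := weighted_sum_cvg d2 ln_word_patterns_ge0 ln_word_patterns_le; apply.
apply: cvg_trans; apply: near_eq_cvg; apply: nearW => N.
rewrite big_distrr /=; apply: eq_big_nat => i /andP[mi _].
by rewrite remainder_termE // (leq_trans m0).
Qed.

(** The bound is uniform in the starting index since [m + 1 <= 2^m], so it can be used with an index
    that varies with [n]. *)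
Lemma remainder_le n m : (0 < m)%N ->
  `|\big[+%R/0]_(m <= i <oo) (#|Delta d n|%:R / d%:R ^+ i.-1 * L i)| <=
  d%:R ^+ 2 * C * #|Delta d n|%:R.
Proof.
move=> m0; have D0 := card_Delta_gt0 n.
rewrite (cvg_lim _ (remainder_cvg m0)) //.
have t0 := weighted_tail_ge0 d2 ln_word_patterns_ge0 ln_word_patterns_le m.
have t1 := weighted_tail_le d2 ln_word_patterns_ge0 ln_word_patterns_le m.
rewrite ger0_norm; last by rewrite !mulr_ge0 // ltW.
rewrite [leRHS]mulrAC; apply: ler_wpM2l; first by rewrite mulr_ge0 // ltW.
apply: (le_trans t1); rewrite -[leRHS]mulr1; apply: ler_wpM2l.
  by have := le_trans (ln_word_patterns_ge0 1) (ln_word_patterns_le 1); rewrite mulr1.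
by rewrite ler_pdivrMr ?exprn_gt0 // mul1r -natrX ler_nat ltn_expl.
Qed.

End FullAxialProduct.

Theorem theorem3p4 (R : realType) (d : nat) (A : finType) (hd : (2 <= d)%N) :
  (forall X : set (nat -> A), X !=set0 -> subshift X ->
    [/\ cvgn (entropy_seq R (full_axial_product d X)),
        cvgn (fun N : nat =>
          \sum_(1 <= i < N) ln (#|word_patterns i X|%:R : R) / d%:R ^+ i.+1)
      & entropy R (full_axial_product d X) =
          (d%:R - 1) ^+ 2 *
          \big[+%R/0]_(1 <= i <oo)
            (ln (#|word_patterns i X|%:R : R) / d%:R ^+ i.+1)])
  /\
  (forall Omega : set (nat -> A), Omega !=set0 -> subshift Omega ->
    (forall n : nat,
      cvgn (fun N : nat => \sum_((rdepth R d n).+1 <= i < N)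
              #|Delta d n|%:R / d%:R ^+ i.-1 *
              ln (#|word_patterns i Omega|%:R : R))) /\
    (forall a : R^nat, a @ \oo --> +oo ->
      (fun n : nat =>
         ln (#|tree_patterns n (full_axial_product d Omega)|%:R : R)) =
      (fun n : nat =>
         #|Delta d n|%:R * entropy R (full_axial_product d Omega) +
         (d%:R - 1) ^+ 2 *
         \big[+%R/0]_((rdepth R d n).+1 <= i <oo)
            (#|Delta d n|%:R / d%:R ^+ i.-1 *
             ln (#|word_patterns i Omega|%:R : R)))
      +o_\oo (fun n : nat => a n * #|Delta d n|%:R)) /\
    (d = 2%N ->
      (fun n : nat =>
         ln (#|tree_patterns n (full_axial_product d Omega)|%:R : R)) =
      (fun n : nat =>
         #|Delta d n|%:R * entropy R (full_axial_product d Omega))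
      +O_\oo (fun n : nat => n%:R : R))).
Proof.
split=> X X0 X_shift.
  split; first by apply: cvgP; exact: entropy_seq_cvg hd X0 X_shift.
    by have := weighted_sum_cvg hd (ln_word_patterns_ge0 R X0)
      (ln_word_patterns_le R X0); apply.
  exact: entropy_full_axial_product.
have error := ln_tree_patterns_error R hd X0 X_shift.
have hE := entropy_full_axial_product R hd X0 X_shift.
have C0 : 0 <= ln (#|A|%:R : R).
  have := le_trans (ln_word_patterns_ge0 R X0 1) (ln_word_patterns_le R X0 1).
  by rewrite mulr1.
split; [|split].
- by move=> n; apply: cvgP; exact: remainder_cvg.
- move=> a a_oo; apply/eqaddoP => eps eps0.
  set C := ln (#|A|%:R : R) in error C0.
  (* The first summand bounds the error term, using [(n + 1) / 2^n <= 1]; the second bounds the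
     remainder sum. Both are relative to the size of [Delta d n]. *)
  pose K := (1 + d%:R) ^+ 2 * C + (d%:R - 1) ^+ 2 * (d%:R ^+ 2 * C).
  near=> n; have D0 : 0 < #|Delta d n|%:R :> R by apply: card_Delta_gt0.
  (* Divergence of [a] is used only here: it absorbs the constant [K] into [eps * a n]. *)
  have aK : K / eps <= a n by near: n; move: a_oo => /cvgryPge; apply.
  apply: (@le_trans _ _ (K * #|Delta d n|%:R)); last first.
    rewrite normrM (gtr0_norm D0) mulrA ler_pM2r //.
    by rewrite mulrC -ler_pdivrMr // (le_trans aK) // ler_norm.
  rewrite /= opprD addrA hE; apply: (le_trans (ler_normB _ _)).
  rewrite /K mulrDl; apply: lerD.
    apply: (le_trans (error n)); rewrite ler_pM2r //.
    rewrite -[leRHS]mulr1; apply: ler_wpM2l; first by rewrite mulr_ge0 // sqr_ge0.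
    by rewrite ler_pdivrMr ?exprn_gt0 // mul1r -natrX ler_nat ltn_expl.
  rewrite normrM (ger0_norm (sqr_ge0 _)) -[leRHS]mulrA; apply: ler_wpM2l.
    exact: sqr_ge0.
  exact: remainder_le.
- move=> d2; subst d; apply/eqaddOP.
  set K := (1 + 2%:R) ^+ 2 * _ in error.
  have K0 : 0 <= K by rewrite mulr_ge0 // sqr_ge0.
  clearbody K.
  near=> k; near=> n; have n0 : (0 < n)%N by near: n; exact: nbhs_infty_ge.
  rewrite /= hE; apply: (le_trans (error n)).
  (* The 4 arises as follows: for [d = 2] the size of [Delta d n] is [2^(n+1) - 1], so the error is
     at most [K * 2 (n + 1)], and [n + 1 <= 2 n] for positive [n]. *)
  have kK : K * 4 <= k by near: k; apply: nbhs_pinfty_ge; exact: num_real.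
  rewrite normr_nat; apply: (@le_trans _ _ (K * 4 * n%:R)); last first.
    by rewrite ler_wpM2r.
  rewrite -!mulrA; apply: ler_wpM2l => //.
  have -> : 4 * n%:R = (2 * n)%:R * 2 :> R by rewrite natrM; ring.
  apply: (@le_trans _ _ (n.+1%:R * 2)); last by rewrite ler_pM2r // ler_nat; lia.
  apply: ler_wpM2l => //; rewrite mulrC ler_pdivrMr ?exprn_gt0 // -exprS.
  have := card_DeltaE R 2 n; have -> : 2%:R - 1 = 1 :> R by lra.
  by rewrite mul1r => ->; rewrite lerBlDr lerDl.
Unshelve. all: by end_near. Qed.
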